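(* Let $(\mathcal{A},\varphi)$ be a $C^*$-probability space and let $\mathbb{X}\in\mathcal{A}$ be an invertible self-adjoint element that is free Poisson distributed with parameters $(\lambda,\alpha)$, where $\lambda>1$ and $\alpha>0$. Put $a=\frac{1}{\sqrt{\lambda-1}}$. Then the random variable $$\mathbb{Y}=\alpha(\lambda-1)^{3/2}\,\mathbb{X}^{-1}-(\lambda-1)^{1/2}\,\mathbb{I}$$ has the standardized free gamma law $\mu_{2a,a^2}$.
   Context: A $C^*$-probability space is a pair $(\mathcal{A},\varphi)$ with $\mathcal{A}$ a unital $C^*$-algebra with unit $\mathbb{I}$ and $\varphi:\mathcal{A}\to\mathbb{C}$ linear with $\varphi(\mathbb{I})=1$ and $\varphi(\mathbb{X}^*\mathbb{X})\ge 0$ for all $\mathbb{X}$. The distribution (law) of a self-adjoint $\mathbb{X}\in\mathcal{A}$ is the probability measure $\mu$ on $\mathbb{R}$ with $\varphi(\mathbb{X}^r)=\int t^r\,\mu(dt)$ for all $r\ge 1$. Free Poisson distribution: for $\lambda>1$ and $\alpha>0$, the free Poisson law with parameters $(\lambda,\alpha)$ is the probability measure supported on $(\alpha(1-\sqrt\lambda)^2,\alpha(1+\sqrt\lambda)^2)$ with density $\frac{1}{2\pi\alpha x}\sqrt{4\lambda\alpha^2-(x-\alpha(1+\lambda))^2}$ with respect to Lebesgue measure. Standardized free gamma law: for $a>0$, $\mu_{2a,a^2}$ is the probability measure on $\mathbb{R}$ with density $$\frac{\sqrt{4(1+a^2)-(x-2a)^2}}{2\pi(1+ax)^2}$$ on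 the interval $\left(2a-2\sqrt{1+a^2},\,2a+2\sqrt{1+a^2}\right)$ (and zero elsewhere). *)

(* Defs.v *)
From HB Require Import structures.
From mathcomp Require Import all_boot all_order all_algebra.
From mathcomp Require Import complex.
From mathcomp Require Import all_classical all_reals all_analysis.

Set Implicit Arguments.
Unset Strict Implicit.
Unset Printing Implicit Defensive.

Import Order.TTheory GRing.Theory Num.Theory.
Import numFieldNormedType.Exports.

Local Open Scope classical_set_scope.
Local Open Scope ring_scope.
Local Open Scope complex_scope.

(* A unital C*-algebra. In a [unitAlgType], [GRing.unit] is exactly two-sided
   invertibility, so the unit-ring structure adds no hypothesis. The norm is a
   field of the structure because Hierarchy-Builder cannot join the normed
   modules of MathComp-Analysis with its algebras; [cstar_complete] says that
   the metric it induces is complete. *)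
HB.mixin Record isCStarAlgebra (R : realType) A of GRing.UnitAlgebra R[i] A := {
  star : A -> A ;
  cstar_norm : A -> R ;
  starK : involutive star ;
  starD : forall x y : A, star (x + y) = star x + star y ;
  starZ : forall (c : R[i]) (x : A), star (c *: x) = Num.conj c *: star x ;
  starM : forall x y : A, star (x * y) = star y * star x ;
  cstar_norm0_eq0 : forall x : A, cstar_norm x = 0 -> x = 0 ;
  ler_cstar_normD : forall x y : A,
    cstar_norm (x + y) <= cstar_norm x + cstar_norm y ;
  cstar_normZ : forall (c : R[i]) (x : A),
    cstar_norm (c *: x) = Normc.normc c * cstar_norm x ;
  ler_cstar_normM : forall x y : A,
    cstar_norm (x * y) <= cstar_norm x * cstar_norm y ;
  cstar_norm_starM : forall x : A, cstar_norm (star x * x) = cstar_norm x ^+ 2 ;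
  cstar_complete : forall u : nat -> A,
    (forall e : R, 0 < e -> exists N : nat, forall m n : nat,
       (N <= m)%N -> (N <= n)%N -> cstar_norm (u m - u n) < e) ->
    exists l : A, (fun n => cstar_norm (u n - l)) @ \oo --> (0 : R)
}.

#[short(type="cstarAlgType")]
HB.structure Definition CStarAlgebra (R : realType) :=
  { A of GRing.UnitAlgebra R[i] A & isCStarAlgebra R A }.

Definition selfadjoint (R : realType) (A : cstarAlgType R) (x : A) : Prop :=
  star x = x.

Definition is_state (R : realType) (A : cstarAlgType R) (phi : {scalar A}) :
    Prop :=
  phi 1 = 1 /\ forall x : A, 0 <= phi (star x * x).

(* [m] only matters through its values on Borel sets; that it is a probability
   measure there is part of the predicate. *)
Definition has_law (R : realType) (A : cstarAlgType R) (phi : {scalar A})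
    (X : A) (m : set (measurableTypeR R) -> \bar R) : Prop :=
  selfadjoint X /\
  exists mu : probability (measurableTypeR R) R,
    (forall B : set (measurableTypeR R), measurable B -> mu B = m B) /\
    forall r : nat, (1 <= r)%N ->
      mu.-integrable setT (fun t : measurableTypeR R => (t ^+ r)%:E) /\
      phi (X ^+ r) = (\int[mu]_(t in setT) (t ^+ r))%:C.

Definition law_of_density (R : realType) (f : R -> R) :
    set (measurableTypeR R) -> \bar R :=
  fun B => (\int[lebesgue_measure]_(x in B) (f x)%:E)%E.

Definition free_poisson_pdf (R : realType) (lambda alpha x : R) : R :=
  if x \in `]alpha * (1 - Num.sqrt lambda) ^+ 2,
             alpha * (1 + Num.sqrt lambda) ^+ 2[
  then (2 * pi * alpha * x)^-1 *
       Num.sqrt (4 * lambda * alpha ^+ 2 - (x - alpha * (1 + lambda)) ^+ 2)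
  else 0.

Definition free_poisson_law (R : realType) (lambda alpha : R) :=
  law_of_density (free_poisson_pdf lambda alpha).

Definition std_free_gamma_pdf (R : realType) (a x : R) : R :=
  if x \in `]2 * a - 2 * Num.sqrt (1 + a ^+ 2),
             2 * a + 2 * Num.sqrt (1 + a ^+ 2)[
  then Num.sqrt (4 * (1 + a ^+ 2) - (x - 2 * a) ^+ 2) /
       (2 * pi * (1 + a * x) ^+ 2)
  else 0.

(* The law $\mu_{2a,a^2}$. *)
Definition std_free_gamma_law (R : realType) (a : R) :=
  law_of_density (std_free_gamma_pdf a).

(* Main.v *)
(* For commuting self-adjoint b, v the state satisfies
   2 |phi (b v)| <= r phi (b^2) + phi (v^2) / r, so phi (X^-k v) is small as soon
   as phi (v^2), a moment of X, is. With w = 1 - X / d, where d is the right end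
   of the support ]c, d[ of the free Poisson law mu, X w^n / d = w^n (1 - w)
   makes the defect phi (X^-k w^n) - \int t^-k (1 - t / d)^n mu(dt) independent
   of n by induction on k, while it is O((1 - c / d)^n); hence it vanishes, and
   the moments of X^-1 are those of 1 / t under mu. It remains to push mu forward
   along t |-> alpha (lambda - 1)^(3/2) / t - (lambda - 1)^(1/2). *)
From HB Require Import structures.
Require Import Defs.
From mathcomp Require Import all_boot all_order all_algebra.
From mathcomp Require Import complex ring lra.
From mathcomp Require Import all_classical all_reals all_analysis.
From mathcomp Require Import measurable_realfun.

Set Implicit Arguments.
Unset Strict Implicit.
Unset Printing Implicit Defensive.

Import Order.TTheory GRing.Theory Num.Theory.
Import numFieldNormedType.Exports.

Local Open Scope classical_set_scope.
Local Open Scope ring_scope.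
Local Open Scope complex_scope.

(** * Self-adjoint elements of a C*-algebra *)

Section SelfAdjoint.
Context {R : realType} {A : cstarAlgType R}.
Implicit Types (x y : A) (r : R).

Lemma star1 : star (1 : A) = 1.
Proof. by rewrite -[LHS]mulr1 -[X in _ * X](starK (1 : A)) -starM mulr1 starK. Qed.

Lemma selfadjoint1 : selfadjoint (1 : A).
Proof. exact: star1. Qed.

Lemma selfadjointD x y : selfadjoint x -> selfadjoint y -> selfadjoint (x + y).
Proof. by rewrite /selfadjoint starD => -> ->. Qed.

Lemma selfadjointZ r x : selfadjoint x -> selfadjoint (r%:C *: x).
Proof.
rewrite /selfadjoint starZ => ->.
by rewrite (_ : Num.conj r%:C = r%:C)//; exact: conjc_real.
Qed.

Lemma selfadjointM x y : GRing.comm x y -> selfadjoint x -> selfadjoint y ->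
  selfadjoint (x * y).
Proof. by rewrite /selfadjoint starM => xy -> ->; rewrite xy. Qed.

Lemma selfadjointX x n : selfadjoint x -> selfadjoint (x ^+ n).
Proof.
move=> hx; elim: n => [|n IH]; first by rewrite expr0; exact: selfadjoint1.
by rewrite exprS; apply: selfadjointM => //; exact: commrX.
Qed.

Lemma selfadjointV x : x \is a GRing.unit -> selfadjoint x -> selfadjoint x^-1.
Proof.
move=> ux hx; apply: (mulIr ux); rewrite mulVr//.
by rewrite -{2}hx -starM divrr// star1.
Qed.

End SelfAdjoint.

(** * Positivity of a state and a Cauchy-Schwarz type bound *)

Section State.
Context {R : realType} {A : cstarAlgType R} (phi : {scalar A}).
Hypothesis hphi : is_state phi.
Implicit Types (x y : A) (r : R).

Lemma state1 : phi 1 = 1. Proof. by case: hphi. Qed.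

Lemma state_sqr_ge0 x : selfadjoint x -> 0 <= phi (x ^+ 2).
Proof. by move=> hx; have := hphi.2 x; rewrite hx -expr2. Qed.

(* Compare the imaginary parts in [0 <= phi ((x + 1)^2)]. *)
Lemma state_real x : selfadjoint x -> phi x = (complex.Re (phi x))%:C.
Proof.
move=> hx; have := state_sqr_ge0 (selfadjointD hx selfadjoint1).
have := state_sqr_ge0 hx.
rewrite !expr2 mulrDr !mulrDl !(mulr1, mul1r) !linearD/=.
rewrite state1 !lecE.
case: (phi x) => u v; case: (phi (x * x)) => u' v' /=.
by move=> /andP[/eqP -> _] /andP[/eqP hv _]; congr (_ +i* _); lra.
Qed.

Let ReD x y :
  complex.Re (phi (x + y)) = complex.Re (phi x) + complex.Re (phi y).
Proof. by rewrite linearD; case: (phi x); case: (phi y). Qed.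

Let ReZ r x : complex.Re (phi (r%:C *: x)) = r * complex.Re (phi x).
Proof. by rewrite linearZ/=; case: (phi x) => u v /=; rewrite mul0r subr0. Qed.

(** Positivity at [(r b + v) ^+ 2]; commutation merges the two cross terms. This is the quadratic
    form in [r] behind Cauchy-Schwarz. *)
Lemma state_addscale_sqr_ge0 (b v : A) r : GRing.comm b v ->
  selfadjoint b -> selfadjoint v ->
  0 <= r ^+ 2 * complex.Re (phi (b ^+ 2)) + 2 * r * complex.Re (phi (b * v))
       + complex.Re (phi (v ^+ 2)).
Proof.
move=> bv hb hv.
have := state_sqr_ge0 (selfadjointD (selfadjointZ r hb) hv).
rewrite (_ : _ ^+ 2 = r%:C *: (r%:C *: b ^+ 2) + r%:C *: (b * v) +
    (r%:C *: (b * v) + v ^+ 2)); last first.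
  by rewrite !expr2 mulrDr !mulrDl -!scalerAl -!scalerAr -bv.
by rewrite lecE => /andP[_]; rewrite !ReD !ReZ; congr (_ <= _); ring.
Qed.

(** Positivity at [r] and at [- r] bounds [2 r |phi (b v)|] by [r^2 phi (b^2) + phi (v^2)], hence by
    [r^2 (phi (b^2) + 1)]. Dividing by [r] gives the claim with a factor 2 to spare. *)
Lemma state_normM_le (b v : A) r : GRing.comm b v ->
  selfadjoint b -> selfadjoint v -> 0 < r ->
  complex.Re (phi (v ^+ 2)) <= r ^+ 2 ->
  `|complex.Re (phi (b * v))| <= r * (complex.Re (phi (b ^+ 2)) + 1).
Proof.
move=> bv hb hv r0 hr.
have b0 : 0 <= complex.Re (phi (b ^+ 2)).
  by have := state_sqr_ge0 hb; rewrite lecE => /andP[].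
have := state_addscale_sqr_ge0 (- r) bv hb hv.
have := state_addscale_sqr_ge0 r bv hb hv.
move: (complex.Re _) b0 (complex.Re _) (complex.Re _) hr => p p0 q s hr h1 h2.
have pr : 0 <= p * r by rewrite mulr_ge0// ltW.
by rewrite ler_norml; apply/andP; split; rewrite -(ler_pM2l r0); nra.
Qed.

End State.

(** * Elements whose value under the state is an integral *)

Section Represents.
Context {R : realType} {A : cstarAlgType R} (phi : {scalar A}).
Context {d : measure_display} {T : measurableType d} (mu : probability T R).
Implicit Types (f g : T -> R) (x y : A) (r : R).

(** This relation passes to linear combinations but not to products, so a hypothesis on powers has
    to cover all exponents at once. *)
Definition represents f x :=
  mu.-integrable setT (EFin \o f) /\ phi x = (\int[mu]_t f t)%:C.

Lemma representsD f g x y : represents f x -> represents g y ->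
  represents (fun t => f t + g t) (x + y).
Proof.
move=> [fi fx] [gi gy]; split; first exact: (integrableD measurableT fi gi).
by rewrite linearD/= fx gy RintegralD// rmorphD.
Qed.

Lemma representsZ r f x : represents f x ->
  represents (fun t => r * f t) (r%:C *: x).
Proof.
move=> [fi fx]; split; first exact: (integrableZl measurableT r fi).
by rewrite linearZ/= fx RintegralZl// rmorphM.
Qed.

Lemma represents0 : represents (fun=> 0) 0.
Proof.
split; first exact: integrable0.
by rewrite linear0 Rintegral_cst// mul0r.
Qed.

Lemma represents_sum (I : Type) (s : seq I) (f : I -> T -> R) (x : I -> A) :
  (forall i, represents (f i) (x i)) ->
  represents (fun t => \sum_(i <- s) f i t) (\sum_(i <- s) x i).
Proof.
move=> fx; elim: s => [|i s IH].
  by under eq_fun do rewrite big_nil; rewrite big_nil; exact: represents0.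
by under eq_fun do rewrite big_cons; rewrite big_cons; exact: representsD.
Qed.

(** Since [u x] and [v 1] commute, both sides have the same binomial expansion, linear in the powers
    of [f] and [x]. It serves for [w = 1 - X / d] and again for [Y], which is affine in [X^-1]. *)
Lemma represents_affineX u v f x :
  (forall n, represents (fun t => f t ^+ n) (x ^+ n)) ->
  forall n, represents (fun t => (u * f t + v) ^+ n)
    ((u%:C *: x + v%:C *: 1) ^+ n).
Proof.
move=> fx n.
have /exprDn_comm -> : GRing.comm (u%:C *: x) (v%:C *: 1).
  by rewrite /GRing.comm -!scalerAl -!scalerAr mul1r mulr1 scalerA mulrC -scalerA.
under eq_fun do rewrite exprDn.
apply: represents_sum => i.
have -> : (u%:C *: x) ^+ (n - i) * (v%:C *: 1) ^+ i *+ 'C(n, i) =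
    (u ^+ (n - i) * v ^+ i *+ 'C(n, i))%:C *: x ^+ (n - i).
  rewrite !exprZn expr1n -scalerAl -scalerAr mulr1 scalerA -scaler_nat scalerA.
  by congr (_ *: _); rewrite mulr_natl rmorphMn rmorphM !rmorphXn.
rewrite (_ : (fun t => _) =
    (fun t => u ^+ (n - i) * v ^+ i *+ 'C(n, i) * f t ^+ (n - i))).
  exact: representsZ.
by apply/funext => t; rewrite exprMn mulrAC mulrnAl.
Qed.

End Represents.

(** Inversion is continuous on the open set of nonzero reals, and the convention [0^-1 = 0] concerns
    a single point. *)
Lemma measurable_invr (R : realType) : measurable_fun [set: R] (fun t : R => t^-1).
Proof.
rewrite -(setvU [set 0]); apply/measurable_funU => //.
  exact: measurableC.
split; last exact: measurable_fun_set1.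
apply: open_continuous_measurable_fun; first by rewrite openC; exact: closed_eq.
by move=> t /[!inE] /= /eqP t0; exact: inv_continuous.
Qed.

Lemma normr_le_geometric_eq0 (R : realType) (D C r : R) : 0 < r < 1 ->
  (forall n, `|D| <= r ^+ n * C) -> D = 0.
Proof.
move=> /andP[r0 r1] DC; apply/eqP; rewrite -normr_le0.
have h : (r ^+ n * C @[n --> \oo] --> (0 : R))%classic.
  rewrite -(mul0r C); apply: cvgMr_tmp; apply: cvg_expr.
  by rewrite ger0_norm// ltW.
by apply: (cvgr_to_ge h); apply: nearW.
Qed.

(** * Moments of the inverse *)

Section InverseMoments.
Context {R : realType} {A : cstarAlgType R} (phi : {scalar A}).
Hypothesis hphi : is_state phi.
Variables (X : A) (mu : probability (measurableTypeR R) R) (c d : R).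
Hypotheses (c0 : 0 < c) (cd : c < d) (mu_cd : mu (~` `]c, d[) = 0).
Hypotheses (uX : X \is a GRing.unit) (hX : selfadjoint X).
Hypothesis momX : forall n, represents phi mu (fun t => t ^+ n) (X ^+ n).

(** All the mass, at most 1, lies in ]c, d[, so a bound on that interval controls the integral over
    the whole line. *)
Lemma bounded_integrable_supp (f : R -> R) (M : R) :
  measurable_fun setT f -> (forall t, t \in `]c, d[ -> `|f t| <= M) ->
  mu.-integrable setT (EFin \o f) /\ `|\int[mu]_t f t| <= M.
Proof.
move=> mf fM.
have mC : measurable (~` `]c, d[%classic : set (measurableTypeR R)).
  exact: measurableC.
have DE : setT `\` ~` `]c, d[ = `]c, d[%classic :> set R.
  by rewrite setTD setCK.
have mucd : (mu `]c, d[%classic < +oo)%E.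
  by apply: le_lt_trans (ltry 1); exact: probability_le1.
have intcd : mu.-integrable `]c, d[ (EFin \o f).
  apply: measurable_bounded_integrable => //.
  - exact: measurable_funTS.
  - exists M; split; first exact: num_real.
    by move=> y My t /= tcd; apply: le_trans (fM _ tcd) (ltW My).
have intT : mu.-integrable setT (EFin \o f).
  apply/(negligible_integrable mC measurableT _ mu_cd); last by rewrite DE.
  exact/measurable_EFinP.
split => //.
rewrite /Rintegral (negligible_integral mC)// DE -/(Rintegral _ _ _).
apply: le_trans (le_normr_Rintegral _ intcd) _ => //.
apply: (@le_trans _ _ (\int[mu]_(t in `]c, d[) M)).
  apply: le_Rintegral => //.
  - exact: integrable_norm.
  - apply: measurable_bounded_integrable => //.
    by exists `|M|; split => [|y My t _]; [exact: num_real|exact: ltW].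
rewrite Rintegral_cst// ler_piMr//.
  (* [M] is nonnegative because it bounds an absolute value at the midpoint. *)
  have /fM : (c + d) / 2 \in `]c, d[ by rewrite in_itv/= !midf_lt.
  exact: le_trans.
rewrite -lee_fin fineK ?probability_le1//.
by rewrite ge0_fin_numE// (le_lt_trans (probability_le1 mu _) (ltry _)).
Qed.

(** The supremum of [1 - t / d] on ]c, d[, hence the decay rate of the powers of [w]. *)
Let rho := 1 - c / d.
Let w := (- d^-1)%:C *: X + 1%:C *: 1.

Let rho01 : 0 < rho < 1.
Proof.
have d0 : 0 < d by exact: lt_trans cd.
by rewrite /rho subr_gt0 ltr_pdivrMr// mul1r cd gtrBl divr_gt0.
Qed.

Let hw : selfadjoint w.
Proof. by apply: selfadjointD; apply: selfadjointZ => //; exact: selfadjoint1. Qed.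

Let momw n : represents phi mu (fun t => (- d^-1 * t + 1) ^+ n) (w ^+ n).
Proof. exact: represents_affineX momX n. Qed.

Let Xw : GRing.comm X w.
Proof.
by rewrite /GRing.comm /w mulrDl mulrDr -!scalerAl -!scalerAr mulr1 mul1r.
Qed.

Let Vw k n : GRing.comm (X^-1 ^+ k) (w ^+ n).
Proof. by apply: commrX; apply/commr_sym/commrX/commrV/commr_sym. Qed.

Let absw_le t : t \in `]c, d[ -> `|- d^-1 * t + 1| <= rho.
Proof.
have d0 : 0 < d by exact: lt_trans cd.
rewrite in_itv/= => /andP[ct td]; rewrite mulNr mulrC addrC ger0_norm.
  by rewrite lerD2l lerN2 ler_pM2r ?invr_gt0// ltW.
by rewrite subr_ge0 ler_pdivrMr// mul1r ltW.
Qed.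

Let absV_le t k : t \in `]c, d[ -> `|t^-1 ^+ k| <= c^-1 ^+ k.
Proof.
rewrite in_itv/= => /andP[ct td]; have t0 : 0 < t by exact: lt_trans ct.
rewrite normrX ger0_norm ?invr_ge0 ?(ltW t0)//.
by apply: lerXn2r; rewrite ?nnegrE ?invr_ge0 ?lef_pV2 ?posrE ?ltW.
Qed.

(** The scalar counterpart of [X^-1 ^+ k * w ^+ n]. *)
Let f k n (t : R) := t^-1 ^+ k * (- d^-1 * t + 1) ^+ n.

Let measurable_f k n : measurable_fun setT (f k n).
Proof.
apply: measurable_funM; apply: measurable_funX; first exact: measurable_invr.
by apply: measurable_funD => //; exact: measurable_funM.
Qed.

Let f_bound k n : mu.-integrable setT (EFin \o f k n) /\
  `|\int[mu]_t f k n t| <= c^-1 ^+ k * rho ^+ n.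
Proof.
apply: bounded_integrable_supp; first exact: measurable_f.
move=> t tcd; rewrite normrM ler_pM// ?absV_le//.
rewrite normrX; apply: lerXn2r; rewrite ?nnegrE ?absw_le//.
by case/andP: rho01 => /ltW.
Qed.

Let f_int k n := (f_bound k n).1.

(* The integrands agree on the support only: at t = 0, where 0^-1 = 0, they
   differ. *)
Let fS k n : \int[mu]_t f k.+1 n.+1 t =
  \int[mu]_t f k.+1 n t - d^-1 * \int[mu]_t f k n t.
Proof.
have fZ : mu.-integrable setT (EFin \o (fun t => d^-1 * f k n t)).
  exact: (integrableZl measurableT d^-1 (f_int k n)).
rewrite -RintegralZl// -RintegralB//; apply/eqP; rewrite -subr_eq0.
rewrite -RintegralB//; last exact: (integrableB measurableT (f_int k.+1 n) fZ).
rewrite -normr_le0; apply: (bounded_integrable_supp _ _).2.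
  apply: measurable_funB; first exact: measurable_f.
  apply: measurable_funB; first exact: measurable_f.
  by apply: measurable_funM => //; exact: measurable_f.
move=> t; rewrite in_itv/= => /andP[ct _].
have t0 : t != 0 by rewrite gt_eqF// (lt_trans c0).
have d0 : d != 0 by rewrite gt_eqF// (lt_trans c0).
rewrite (_ : _ - _ = 0) ?normr0// /f !exprS; field.
by rewrite t0 d0.
Qed.

(** Here [state_normM_le] is applied with [r = rho ^+ n]: [phi (w ^+ (2 n))] is a combination of
    known moments and equals an integral bounded by [rho ^+ (2 n)]. The unknown moment of [X^-1]
    enters only as a constant independent of [n]. *)
Let bound_phi k n : `|complex.Re (phi (X^-1 ^+ k * w ^+ n))| <=
  rho ^+ n * (complex.Re (phi ((X^-1 ^+ k) ^+ 2)) + 1).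
Proof.
apply: (state_normM_le hphi) => //.
- by apply: selfadjointX; exact: selfadjointV.
- exact: selfadjointX.
- by apply: exprn_gt0; case/andP: rho01.
- rewrite -!exprM (momw _).2 /=; have := (f_bound 0 (n * 2)).2.
  rewrite expr0 mul1r; apply: le_trans; apply: le_trans (ler_norm _).
  by rewrite le_eqVlt; apply/orP; left; apply/eqP; apply: eq_Rintegral => t _;
    rewrite /f expr0 mul1r.
Qed.

Lemma represents_invX_affine k n : represents phi mu (f k n) (X^-1 ^+ k * w ^+ n).
Proof.
split; first exact: f_int.
elim: k n => [|k IH] n.
  rewrite expr0 mul1r (momw n).2; congr _%:C.
  by apply: eq_Rintegral => t _; rewrite /f expr0 mul1r.
(* The element is self-adjoint, so comparing real parts suffices. *)
rewrite (state_real hphi); last first.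
  by apply: selfadjointM => //; apply: selfadjointX => //; exact: selfadjointV.
congr _%:C; apply/eqP; rewrite -subr_eq0; apply/eqP.
(* The defect at exponent [m]. Both of its terms obey the same recursion in [m], with correction
   terms of level [k] that agree by [IH]; hence [D] is constant. *)
set D := fun m => complex.Re (phi (X^-1 ^+ k.+1 * w ^+ m)) - \int[mu]_t f k.+1 m t.
have DS m : D m.+1 = D m.
  rewrite /D fS.
  have -> : X^-1 ^+ k.+1 * w ^+ m.+1 =
      X^-1 ^+ k.+1 * w ^+ m + (- d^-1)%:C *: (X^-1 ^+ k * w ^+ m).
    rewrite [w ^+ m.+1]exprS {1}/w mulrDl mulrDr -!scalerAl mul1r scale1r addrC.
    by rewrite -scalerAr mulrA exprSr -(mulrA _ X^-1 X) mulVr// mulr1.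
  rewrite linearD linearZ/= IH; case: (phi _) => ? ? /=; ring.
have Dn m : D m = D n.
  suff D0 l : D l = D 0 by rewrite !D0.
  by elim: l => // l <-.
rewrite -/(D n).
(* The constant adds the bounds for the state and for the integral; both carry the factor
   [rho ^+ m]. *)
apply: (normr_le_geometric_eq0
  (C := complex.Re (phi ((X^-1 ^+ k.+1) ^+ 2)) + 1 + c^-1 ^+ k.+1) rho01) => m.
rewrite -(Dn m) (le_trans (ler_normB _ _))// mulrDr lerD ?bound_phi//.
by rewrite mulrC; exact: (f_bound k.+1 m).2.
Qed.

Lemma represents_inv k : represents phi mu (fun t => t^-1 ^+ k) (X^-1 ^+ k).
Proof.
have := represents_invX_affine k 0; rewrite expr0 mulr1 /f.
by congr (represents _ _ _ _); apply/funext => t; rewrite expr0 mulr1.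
Qed.

End InverseMoments.

(** * Measures given by densities *)

Section LawOfDensity.
Context {R : realType}.
Implicit Types (f : R -> R) (B S : set (measurableTypeR R)).

Lemma law_of_density_supp f S B : (forall x, ~ S x -> f x = 0) ->
  law_of_density f B = law_of_density f (B `&` S).
Proof.
move=> f0; rewrite /law_of_density integral_mkcond [RHS]integral_mkcond.
congr (integral _ _ _); apply/funext => x.
rewrite !patchE in_setI; have [//|xS] := boolP (x \in S); first by rewrite andbT.
by rewrite andbF f0 ?if_same// => Sx; move: xS; rewrite mem_set.
Qed.

(** Turns the bare set function into a measure, so that uniqueness of measures applies to it. *)
Lemma law_of_density_measure f : measurable_fun setT f -> (forall x, 0 <= f x) ->
  exists m : {measure set (measurableTypeR R) -> \bar R},
    forall B, m B = law_of_density f B.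
Proof.
move=> mf f0.
have l0 : law_of_density f set0 = 0%E by exact: integral_set0.
have lge0 B : (0 <= law_of_density f B)%E.
  by apply: integral_ge0 => x _; rewrite lee_fin.
have lsigma : semi_sigma_additive (law_of_density f).
  apply: semi_sigma_additive_nng_induced => [|x]; last by rewrite lee_fin.
  exact/measurable_EFinP.
pose h := isMeasure.Build _ _ _ (law_of_density f) l0 lge0 lsigma.
pose m : {measure set (measurableTypeR R) -> \bar R} :=
  HB.pack (law_of_density f) h.
by exists m.
Qed.

(** Closed right rays generate the Borel sets, are stable under intersection (take the larger
    endpoint), and those starting at [- n] exhaust the line with finite mass. *)
Lemma measure_unique_rays (m1 m2 : {measure set (measurableTypeR R) -> \bar R}) :
  (m1 setT < +oo)%E ->
  (forall x : R, m1 `[x, +oo[%classic = m2 `[x, +oo[%classic) ->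
  forall B, measurable B -> m1 B = m2 B.
Proof.
move=> m1fin m12 B mB.
apply: (@measure_unique _ R (measurableTypeR R) (@RGenCInfty.G R)
  (fun n => `[(- n%:R : R), +oo[%classic) _ _ _ _ m1 m2) => //.
- exact: RGenCInfty.measurableE.
- move=> _ _ [x ->] [y ->]; exists (Num.max x y); apply/seteqP; split => z /=;
    rewrite !in_itv/= !andbT ge_max; first by case=> -> ->.
  by case/andP.
- by move=> n; exists (- n%:R).
- apply/seteqP; split => // y _; exists (Num.truncn `|y|).+1 => //=.
  rewrite in_itv/= andbT lerNl; apply: le_trans (ler_norm _) _; rewrite normrN.
  exact/ltW/truncnS_gt.
- by move=> _ [x ->]; exact: m12.
- move=> n; apply: le_lt_trans m1fin; apply: le_measure; rewrite ?inE//.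
Qed.

End LawOfDensity.

(** * Closed forms and regularity of the two densities *)

Section Densities.
Context {R : realType}.
Implicit Types (x s alpha lambda a : R).

(* Outside the support the radicand is nonpositive, so [Num.sqrt] gives 0. *)
Lemma free_poisson_pdfE lambda alpha x : 0 <= lambda -> 0 < alpha ->
  free_poisson_pdf lambda alpha x = (2 * pi * alpha * x)^-1 *
    Num.sqrt (4 * lambda * alpha ^+ 2 - (x - alpha * (1 + lambda)) ^+ 2).
Proof.
move=> l0 a0; rewrite /free_poisson_pdf; case: ifPn => //.
rewrite in_itv/= negb_and -!leNgt => hx.
rewrite ler0_sqrtr ?mulr0// -{1}(sqr_sqrtr l0).
move: hx (sqrtr_ge0 lambda) (sqr_sqrtr l0); set r := Num.sqrt lambda => hx r0 <-.
have ar : 0 <= alpha * r by rewrite mulr_ge0// ltW.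
(* The factors are the right end of the support minus [x], and [x] minus the left end; outside the
   support their signs are opposite or one vanishes. *)
rewrite (_ : _ - _ = (2 * (alpha * r) - (x - alpha * (1 + r ^+ 2))) *
  (2 * (alpha * r) + (x - alpha * (1 + r ^+ 2)))); last by ring.
case/orP : hx => hx.
- apply: mulr_ge0_le0; nra.
- apply: mulr_le0_ge0; nra.
Qed.

Lemma std_free_gamma_pdfE a x :
  std_free_gamma_pdf a x = Num.sqrt (4 * (1 + a ^+ 2) - (x - 2 * a) ^+ 2) /
       (2 * pi * (1 + a * x) ^+ 2).
Proof.
rewrite /std_free_gamma_pdf; case: ifPn => //.
rewrite in_itv/= negb_and -!leNgt => hx.
have l0 : 0 <= 1 + a ^+ 2 by rewrite addr_ge0// sqr_ge0.
rewrite ler0_sqrtr ?mul0r// -{1}(sqr_sqrtr l0).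
move: hx (sqrtr_ge0 (1 + a ^+ 2)); set r := Num.sqrt _ => hx r0.
rewrite (_ : _ - _ = (2 * r - (x - 2 * a)) * (2 * r + (x - 2 * a))); last by ring.
case/orP : hx => hx.
- apply: mulr_ge0_le0; nra.
- apply: mulr_le0_ge0; nra.
Qed.

Lemma std_free_gamma_pdf_ge0 a x : 0 <= std_free_gamma_pdf a x.
Proof.
rewrite std_free_gamma_pdfE divr_ge0 ?sqrtr_ge0// mulr_ge0 ?sqr_ge0//.
by rewrite mulr_ge0// pi_ge0.
Qed.

Lemma measurable_std_free_gamma_pdf a : measurable_fun setT (std_free_gamma_pdf a).
Proof.
rewrite (funext (std_free_gamma_pdfE a)); apply: measurable_funM.
  apply: measurableT_comp.
    by apply: continuous_measurable_fun; exact: sqrt_continuous.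
  apply: measurable_funB => //; apply: measurable_funX.
  exact: measurable_funB.
apply: measurableT_comp; first exact: measurable_invr.
apply: measurable_funM => //; apply: measurable_funX.
by apply: measurable_funD => //; exact: measurable_funM.
Qed.

(** In the closed form [Num.sqrt] is continuous on the whole line, so the ends of the support cause
    no jump; only a zero of the denominator must be avoided. *)
Lemma continuous_std_free_gamma_pdf a x : 1 + a * x != 0 ->
  {for x, continuous (std_free_gamma_pdf a)}.
Proof.
move=> ax; rewrite (funext (std_free_gamma_pdfE a)).
apply: (@continuousM R R
  (fun y => Num.sqrt (4 * (1 + a ^+ 2) - (y - 2 * a) ^+ 2))
  (fun y => (2 * pi * (1 + a * y) ^+ 2)^-1) x).
  apply: (@continuous_comp R R R _ (@Num.sqrt R) x); last exact: sqrt_continuous.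
  apply: (@continuousB R R R (fun=> _) (fun y => (y - 2 * a) ^+ 2) x).
    exact: cvg_cst.
  apply: (@continuous_comp R R R (fun y => y - 2 * a) (fun y => y ^+ 2) x).
    by apply: (@continuousB R R R id (fun=> _) x); [exact: cvg_id|exact: cvg_cst].
  exact: exprn_continuous.
apply: (@continuous_comp R R R _ (@GRing.inv R) x).
  apply: (@continuousM R R (fun=> _) (fun y => (1 + a * y) ^+ 2) x).
    exact: cvg_cst.
  apply: (@continuous_comp R R R (fun y => 1 + a * y) (fun y => y ^+ 2) x).
    apply: (@continuousD R R R (fun=> _) (fun y => a * y) x); first exact: cvg_cst.
    by apply: (@continuousM R R (fun=> _) id x); [exact: cvg_cst|exact: cvg_id].
  exact: exprn_continuous.
by apply: inv_continuous; rewrite !mulf_neq0 ?sqrf_eq0 ?(gt_eqF (pi_gt0 R)).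
Qed.

End Densities.

(** * Pushing the free Poisson law forward along the reciprocal map *)

Section Reciprocal.
Context {R : realType} (s alpha : R).
Hypotheses (s0 : 0 < s) (alpha0 : 0 < alpha).

(* s = sqrt (lambda - 1) = 1 / a; F maps the free Poisson support ]c, d[ onto
   the support of mu_{2a,a^2}, reversing the order. *)
Let lambda := 1 + s ^+ 2.
Let r := Num.sqrt lambda.
Let c := alpha * (1 - r) ^+ 2.
Let d := alpha * (1 + r) ^+ 2.
Let F (t : R) := alpha * s ^+ 3 * t^-1 - s.

Let lambda_ge0 : 0 <= lambda. Proof. by rewrite addr_ge0// sqr_ge0. Qed.

Let rE : r ^+ 2 = 1 + s ^+ 2. Proof. exact: sqr_sqrtr. Qed.

Let r1 : 1 < r.
Proof.
rewrite -(ltr_pXn2r (_ : 0 < 2)%N) ?nnegrE ?sqrtr_ge0// rE expr1n ltrDl.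
exact: exprn_gt0.
Qed.

Let c0 : 0 < c.
Proof. by rewrite mulr_gt0// exprn_even_gt0//= subr_eq0 lt_eqF. Qed.

Let cd : c < d.
Proof. by rewrite ltr_pM2l//; move: r1; nra. Qed.

Let FV a b : 0 < a -> 0 < b -> (F a < F b) = (b < a).
Proof.
move=> a0 b0; rewrite ltrD2r ltr_pM2l ?mulr_gt0 ?exprn_gt0//.
by rewrite ltf_pV2.
Qed.

Let FVe a b : 0 < a -> 0 < b -> (F a <= F b) = (b <= a).
Proof. by move=> a0 b0; rewrite leNgt FV// -leNgt. Qed.

Let sqrt1a : Num.sqrt (1 + s^-1 ^+ 2) = r / s.
Proof.
rewrite -[RHS]ger0_norm ?divr_ge0 ?sqrtr_ge0 ?ltW// -sqrtr_sqr.
by congr Num.sqrt; rewrite expr_div_n rE; field; rewrite gt_eqF.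
Qed.

Let Fc : F c = 2 * s^-1 + 2 * Num.sqrt (1 + s^-1 ^+ 2).
Proof.
have n1 : 1 - r != 0 by rewrite subr_eq0 lt_eqF.
(* This factor clears all denominators; then [s ^+ 2 = r ^+ 2 - 1] leaves a polynomial identity in
   [r]. *)
apply: (mulIf (_ : s * (1 - r) ^+ 2 != 0)).
  by rewrite mulf_neq0 ?(gt_eqF s0) ?sqrf_eq0.
rewrite sqrt1a /F /c mulrBl.
rewrite [X in X - _](_ : _ = (s ^+ 2) ^+ 2); last by field; rewrite n1 gt_eqF.
rewrite (_ : (_ + _) * _ = 2 * (1 + r) * (1 - r) ^+ 2); last first.
  by field; rewrite gt_eqF.
rewrite (_ : s * (s * _) = s ^+ 2 * (1 - r) ^+ 2); last by ring.
rewrite (_ : s ^+ 2 = r ^+ 2 - 1); last by rewrite rE; ring.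
ring.
Qed.

Let Fd : F d = 2 * s^-1 - 2 * Num.sqrt (1 + s^-1 ^+ 2).
Proof.
have n1 : 1 + r != 0 by rewrite gt_eqF// addr_gt0// (lt_trans ltr01).
apply: (mulIf (_ : s * (1 + r) ^+ 2 != 0)).
  by rewrite mulf_neq0 ?(gt_eqF s0) ?sqrf_eq0.
rewrite sqrt1a /F /d mulrBl.
rewrite [X in X - _](_ : _ = (s ^+ 2) ^+ 2); last by field; rewrite n1 gt_eqF.
rewrite (_ : (_ - _) * _ = 2 * (1 - r) * (1 + r) ^+ 2); last first.
  by field; rewrite gt_eqF.
rewrite (_ : s * (s * _) = s ^+ 2 * (1 + r) ^+ 2); last by ring.
rewrite (_ : s ^+ 2 = r ^+ 2 - 1); last by rewrite rE; ring.
ring.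
Qed.

Let is_deriveF (t : R) : t != 0 ->
  is_derive t 1 F (- (alpha * s ^+ 3) * t^-1 ^+ 2).
Proof.
move=> t0; have dV := @is_deriveV R id t 1 1 t0 (is_derive_id _ _).
apply: is_derive_eq; rewrite subr0 /GRing.scale/= exprVn; ring.
Qed.

Let F'_cvg (x : R) : 0 < x ->
  F^`()%classic t @[t --> x] --> - (alpha * s ^+ 3) * x^-1 ^+ 2.
Proof.
move=> x0.
have cG : {for x, continuous (fun t : R => - (alpha * s ^+ 3) * t^-1 ^+ 2)}.
  apply: (@continuous_comp R R R (@GRing.inv R)
    (fun y => - (alpha * s ^+ 3) * y ^+ 2) x).
    by apply: inv_continuous; rewrite gt_eqF.
  by apply: continuousM; [exact: cvg_cst|exact: exprn_continuous].
(* The derivative formula is available at nonzero points, and points near [x] are positive. *)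
apply: cvg_trans cG; apply: near_eq_cvg; near=> t.
rewrite derive1E; apply/esym.
have t0 : t != 0 by rewrite gt_eqF//; near: t; exact: lt_nbhsr.
by have [_ ->] := is_deriveF t0.
Unshelve. all: end_near. Qed.

(** Change of variables along the decreasing [F]: the gamma density at [F x] times [- F'(x)] is the
    free Poisson density at [x]. *)
Lemma gamma_poisson_subst t : c <= t <= d ->
  law_of_density (std_free_gamma_pdf s^-1) `[F t, F c]%classic =
  law_of_density (free_poisson_pdf lambda alpha) `[c, t]%classic.
Proof.
move=> /andP[ct td]; rewrite /law_of_density.
rewrite integration_by_substitution_decreasing //.
- apply: eq_integral => x; rewrite inE/= in_itv/= => /andP[cx xt].
  have x0 : 0 < x by exact: lt_le_trans cx.
  have [_ F'x] := is_deriveF (lt0r_neq0 x0).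
  rewrite !fctE /= derive1E F'x std_free_gamma_pdfE free_poisson_pdfE//.
  (* The two radicands differ by a perfect square, which leaves the root as [s / x]. *)
  rewrite (_ : 4 * (1 + _) - _ = (s / x) ^+ 2 *
    (4 * lambda * alpha ^+ 2 - (x - alpha * (1 + lambda)) ^+ 2)); last first.
    by rewrite /F /lambda; field; rewrite !gt_eqF.
  rewrite sqrtrM ?sqr_ge0// sqrtr_sqr ger0_norm ?divr_ge0 ?ltW//.
  rewrite (_ : 1 + s^-1 * F x = alpha * s ^+ 2 / x); last first.
    by rewrite /F; field; rewrite !gt_eqF.
  congr _%:E; move: pi (pi_gt0 R) => p p0; field.
  by rewrite !gt_eqF.
- move=> x y; rewrite !in_itv/= => /andP[cx _] /andP[cy _] xy.
  by rewrite FV// (lt_le_trans c0).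
- move=> x; rewrite in_itv/= => /andP[cx _].
  have x0 : 0 < x by exact: lt_trans cx.
  have [_ F'x] := is_deriveF (lt0r_neq0 x0).
  by rewrite /continuous_at derive1E F'x; exact: F'_cvg.
- apply: (cvgP _ (cvg_at_right_filter (F'_cvg c0))).
- apply: (cvgP _ (cvg_at_left_filter (F'_cvg (lt_le_trans c0 ct)))).
- have cF x : 0 < x -> {for x, continuous F}.
    move=> x0; apply: differentiable_continuous; apply/derivable1_diffP.
    by have [] := is_deriveF (lt0r_neq0 x0).
  split.
  + move=> x; rewrite in_itv/= => /andP[cx _].
    by have [] := is_deriveF (lt0r_neq0 (lt_trans c0 cx)).
  + by apply: cvg_at_right_filter; exact: cF.
  + by apply: cvg_at_left_filter; apply: cF; exact: lt_le_trans ct.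
(* On [F t, F c] the base [1 + s^-1 * x] of the denominator is at least its value
   [alpha * s ^+ 2 / t] at [F t], which is positive. *)
- apply: continuous_in_subspaceT => x; rewrite inE/= in_itv/= => /andP[Ftx _].
  have t0 : 0 < t by exact: lt_le_trans ct.
  have x0 : 0 < 1 + s^-1 * x.
    apply: (@lt_le_trans _ _ (1 + s^-1 * F t)); last first.
      by rewrite lerD2l ler_pM2l// invr_gt0.
    rewrite (_ : 1 + s^-1 * F t = alpha * s ^+ 2 / t).
      by rewrite divr_gt0// mulr_gt0// exprn_gt0.
    by rewrite /F; field; rewrite !gt_eqF.
  by apply: continuous_std_free_gamma_pdf; rewrite gt_eqF.
Qed.

Lemma free_poisson_law_supp B :
  free_poisson_law lambda alpha B =
  free_poisson_law lambda alpha (B `&` `]c, d[%classic).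
Proof.
apply: law_of_density_supp => x /= /negP xcd.
by rewrite /free_poisson_pdf (negbTE xcd).
Qed.

Lemma std_free_gamma_law_supp B :
  std_free_gamma_law s^-1 B =
  std_free_gamma_law s^-1 (B `&` `]F d, F c[%classic).
Proof.
apply: law_of_density_supp => x /= /negP; rewrite Fc Fd => xcd.
by rewrite /std_free_gamma_pdf (negbTE xcd).
Qed.

(** Restricting to the supports leaves only positive arguments, where [F] decreases; the preimage of
    a ray then becomes an interval starting at [c], to which [gamma_poisson_subst] applies. *)
Lemma free_poisson_law_preimage_ray x :
  free_poisson_law lambda alpha (F @^-1` `[x, +oo[%classic) =
  std_free_gamma_law s^-1 `[x, +oo[%classic.
Proof.
have d0 : 0 < d by exact: lt_trans cd.
have Fdc : F d < F c by rewrite FV.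
(* Clamping x to [F d, F c] changes neither ray within the supports. *)
pose y := Num.min (F c) (Num.max (F d) x).
have ydc : F d <= y <= F c.
  by rewrite le_min ge_min le_max !lexx (ltW Fdc) !orTb.
have xyE z : F d < z < F c -> (x <= z) = (y <= z).
  by move=> /andP[dz zc]; rewrite ge_min leNgt zc ge_max (ltW dz).
have ys0 : 0 < y + s.
  have [dy _] := andP ydc; apply: lt_le_trans (_ : F d + s <= _).
    by rewrite subrK divr_gt0// mulr_gt0// exprn_gt0.
  by rewrite lerD2r.
(* The solution of [F t = y]; the denominator is positive because [y + s] is at least
   [F d + s = alpha * s ^+ 3 / d]. *)
pose t := alpha * s ^+ 3 / (y + s).
have t0 : 0 < t by rewrite divr_gt0// mulr_gt0// exprn_gt0.
have Ft : F t = y by rewrite /F /t; field; rewrite !gt_eqF.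
have ctd : c <= t <= d by rewrite -FVe// -[t <= d]FVe// Ft andbC.
rewrite free_poisson_law_supp std_free_gamma_law_supp.
transitivity (free_poisson_law lambda alpha (`[c, t] `&` `]c, d[)%classic).
  congr (free_poisson_law _ _); apply/seteqP; split => u /= [];
    rewrite !in_itv/= ?andbT => h1 /[dup] cud /andP[cu ud]; split => //;
    have u0 := lt_trans c0 cu;
    have Fu : F d < F u < F c by rewrite !FV// cu ud.
  - by rewrite (ltW cu) -FVe// Ft -xyE.
  - by rewrite xyE// -Ft FVe//; case/andP: h1.
rewrite -free_poisson_law_supp.
transitivity (std_free_gamma_law s^-1 `[F t, F c]%classic).
  exact/esym/gamma_poisson_subst.
rewrite std_free_gamma_law_supp; congr (std_free_gamma_law _ _).
apply/seteqP; split => u /= []; rewrite !in_itv/= ?andbT => h1 /[dup] cud;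
  move=> /andP[cu ud]; split => //; rewrite Ft in h1 *.
- by rewrite xyE//; case/andP: h1.
- by rewrite -xyE// h1 ltW.
Qed.

Lemma measurable_reciprocal :
  @measurable_fun _ _ (measurableTypeR R) (measurableTypeR R) setT F.
Proof.
change (measurable_fun [set: R] F).
by apply: measurable_funB => //; apply: measurable_funM => //; exact: measurable_invr.
Qed.

Let g : {mfun measurableTypeR R >-> measurableTypeR R} :=
  HB.pack F (isMeasurableFun.Build _ _ (measurableTypeR R) (measurableTypeR R) F
    measurable_reciprocal).

(** The push-forward of [mu] is a finite measure that agrees with the free gamma law on closed right
    rays. *)
Lemma free_poisson_reciprocal_law (mu : probability (measurableTypeR R) R) :
  (forall B : set (measurableTypeR R), measurable B ->
     mu B = free_poisson_law lambda alpha B) ->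
  forall B : set (measurableTypeR R), measurable B ->
    mu (F @^-1` B) = std_free_gamma_law s^-1 B.
Proof.
move=> hmu B mB.
have [nu nuE] := law_of_density_measure (measurable_std_free_gamma_pdf s^-1)
  (std_free_gamma_pdf_ge0 s^-1).
rewrite -[RHS]nuE.
apply: (@measure_unique_rays _ (distribution mu g)) => // [|x].
  by apply: le_lt_trans (ltry 1);
    exact: (@probability_le1 _ _ _ (distribution mu g)).
rewrite nuE -[RHS]free_poisson_law_preimage_ray -hmu// -[X in measurable X]setTI.
exact: measurable_reciprocal.
Qed.

Lemma free_poisson_law_compl (mu : probability (measurableTypeR R) R) :
  (forall B : set (measurableTypeR R), measurable B ->
     mu B = free_poisson_law lambda alpha B) ->
  mu (~` `]c, d[%classic) = 0%E.
Proof.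
move=> hmu; rewrite hmu; last exact: measurableC.
by rewrite free_poisson_law_supp setICl /free_poisson_law /law_of_density integral_set0.
Qed.

Lemma has_law_reciprocal {A : cstarAlgType R} (phi : {scalar A}) (X : A) :
  is_state phi -> X \is a GRing.unit -> selfadjoint X ->
  has_law phi X (free_poisson_law lambda alpha) ->
  has_law phi ((alpha * s ^+ 3)%:C *: X^-1 - s%:C *: 1) (std_free_gamma_law s^-1).
Proof.
move=> hphi uX hX [_ [mu [hmu momX]]].
(* [has_law] starts at exponent 1; exponent 0 is the normalization of [phi] and [mu]. *)
have momX0 n : represents phi mu (fun t => t ^+ n) (X ^+ n).
  case: n => [|n]; last exact: momX.
  split; first exact: finite_measure_integrable_cst.
  rewrite state1// Rintegral_cst// mul1r.
  have mu1 : fine (mu setT) = 1 by rewrite probability_setT.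
  by congr _%:C; exact/esym.
have repV := represents_inv hphi c0 cd (free_poisson_law_compl hmu) uX hX momX0.
rewrite (_ : _ - _ = (alpha * s ^+ 3)%:C *: X^-1 + (- s)%:C *: 1); last first.
  by rewrite rmorphN scaleNr.
split.
  apply: selfadjointD; apply: selfadjointZ; last exact: selfadjoint1.
  exact: selfadjointV.
(* The witness is the image of [mu] under [F]; its moments are integrals of powers of [F] against
   [mu], which [represents_affineX] identifies. *)
exists (distribution mu g); split; first exact: free_poisson_reciprocal_law.
move=> n _; have [iF ->] := represents_affineX (alpha * s ^+ 3) (- s) repV n.
have mX : measurable_fun setT (fun t : measurableTypeR R => (t ^+ n)%:E).
  by apply/measurable_EFinP; exact: measurable_funX.
split; first exact: integrable_pushforward.
by congr _%:C; rewrite /Rintegral integral_pushforward.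
Qed.

End Reciprocal.

(** * Return to the parameters [lambda] and [a] *)

Theorem mainTheorem5 (R : realType) (A : cstarAlgType R) (phi : {scalar A})
    (X : A) (lambda alpha : R)
    (hphi : is_state phi)
    (hlambda : 1 < lambda) (halpha : 0 < alpha)
    (hXunit : X \is a GRing.unit) (hXsa : selfadjoint X)
    (hXlaw : has_law phi X (free_poisson_law lambda alpha)) :
  let a : R := 1 / Num.sqrt (lambda - 1) in
  let Y : A := (alpha * (lambda - 1) `^ (3 / 2))%:C *: X^-1
               - ((lambda - 1) `^ (1 / 2))%:C *: 1 in
  has_law phi Y (std_free_gamma_law a).
Proof.
have l1 : 0 < lambda - 1 by rewrite subr_gt0.
set s := Num.sqrt (lambda - 1) => a Y.
have s0 : 0 < s by rewrite sqrtr_gt0.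
have sE : (lambda - 1) `^ (1 / 2) = s by rewrite div1r powR12_sqrt// ltW.
have s3E : (lambda - 1) `^ (3 / 2) = s ^+ 3.
  rewrite (_ : 3 / 2 = 1 / 2 * 3%:R); last by field.
  by rewrite powRrM sE powR_mulrn ?ltW.
have lE : lambda = 1 + s ^+ 2 by rewrite sqr_sqrtr ?ltW//; ring.
rewrite /Y /a sE s3E div1r; apply: has_law_reciprocal => //.
by rewrite -lE.
Qed.
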